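(* Let $c>0$, let $\mathbb{C}\in\mathbb{R}^{N_2\times N_1}$ be the discrete curl matrix, and let $\mathbb{Q}_1\in\mathbb{R}^{N_1\times N_1}$ and $\tilde{\mathbb{M}}_2\in\mathbb{R}^{N_2\times N_2}$ be arbitrary symmetric matrices. For $\tau\in\mathbb{R}$ define the shear maps on $\mathbb{R}^{2N_1}\ni(\mathbf{a},\mathbf{e})$ (with $\mathbf{a},\mathbf{e}\in\mathbb{R}^{N_1}$) $$\Phi^{\mathbf{e}}_\tau:(\mathbf{a},\mathbf{e})\mapsto(\mathbf{a}-\tau\,\mathbb{Q}_1\mathbf{e},\ \mathbf{e}),\qquad \Phi^{\mathbf{a}}_\tau:(\mathbf{a},\mathbf{e})\mapsto(\mathbf{a},\ \mathbf{e}+\tau\,c^2\,\mathbb{C}^T\tilde{\mathbb{M}}_2\mathbb{C}\,\mathbf{a}).$$ Then the one-step map $\Phi_\tau$ composed from these shear maps via any splitting scheme is symplectic with respect to the canonical symplectic form $\Omega=\begin{bmatrix}0&I\\-I&0\end{bmatrix}$ on $\mathbb{R}^{2N_1}$; that is, its Jacobian $J$ satisfies $J^T\Omega J=\Omega$.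
   Context: Discrete curl matrix: let $\boldsymbol{\Lambda}^1=(\Lambda^1_i)_{i=1}^{N_1}$ and $\boldsymbol{\Lambda}^2=(\Lambda^2_j)_{j=1}^{N_2}$ be bases of finite element spaces of differential 1-forms and 2-forms on a simplicial or cubical mesh, with the exterior derivative $d$ mapping the 1-form space into the 2-form space. The matrix $\mathbb{C}\in\mathbb{R}^{N_2\times N_1}$ is the real matrix representing $d$ in these bases, i.e. $\mathbb{C}^T\boldsymbol{\Lambda}^2=d\boldsymbol{\Lambda}^1$, so that $d(\sum_i a_i\Lambda^1_i)=\sum_j(\mathbb{C}\mathbf{a})_j\Lambda^2_j$. Here $c$ is the speed of light, $I$ is the $N_1\times N_1$ identity matrix, and $0$ is the $N_1\times N_1$ zero matrix; the block structure of $\Omega$ corresponds to the ordering $(\mathbf{a},\mathbf{e})$. The matrices $\mathbb{Q}_1$ and $\tilde{\mathbb{M}}_2$ play the role of approximations of an inverse 1-form mass matrix and a 2-form mass matrix, but nothing is assumed about them beyond symmetry. A one-step map composed via a splitting scheme is a finite composition, in any order, of maps of the form $\Phi^{\mathbf{e}}_{\alpha\tau}$ and $\Phi^{\mathbf{a}}_{\beta\tau}$ with real coefficients $\alpha,\beta$ (for example the Strang splitting $\Phi^{\mathbf{e}}_{\tau/2}\circ\Phi^{\mathbf{a}}_{\tau}\circ\Phi^{\mathbf{e}}_{\tau/2}$, Lie–Trotter splitting, or higher-order compositions). *)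

(* Defs.v *)
From HB Require Import structures.
From mathcomp Require Import all_boot all_order all_algebra.
From mathcomp Require Import all_classical all_reals all_analysis.

Set Implicit Arguments.
Unset Strict Implicit.
Unset Printing Implicit Defensive.

Import Order.TTheory GRing.Theory Num.Theory.
Import numFieldNormedType.Exports.

Local Open Scope classical_set_scope.
Local Open Scope ring_scope.

(* Faces in the sense of convex geometry: for a simplex or a parallelotope these
   are exactly its combinatorial faces, together with set0 and the cell itself. *)
Definition is_face (R : realType) (n : nat) (F K : set 'rV[R]_n) : Prop :=
  [/\ F `<=` K,
      (forall (x y : 'rV[R]_n) (t : R),
         F x -> F y -> 0 <= t <= 1 -> F (t *: x + (1 - t) *: y)) &
      (forall (x y : 'rV[R]_n) (t : R),
         K x -> K y -> 0 < t < 1 -> F (t *: x + (1 - t) *: y) -> F x /\ F y)].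

Inductive cell_shape := Simplicial | Cubical.

Definition ref_cell (R : realType) (n : nat) (s : cell_shape) :
    set 'rV[R]_n :=
  match s with
  | Simplicial => [set x | (forall i, 0 <= x 0 i) /\ \sum_i x 0 i <= 1]
  | Cubical => [set x | forall i, 0 <= x 0 i <= 1]
  end.

Arguments ref_cell : clear implicits.

(* A conforming mesh whose cells are nondegenerate affine images of the
   reference cell. Periodic meshes are included: points of 'rV_n differing by an
   element of [period] are identified; [period] is [set 0] for an ordinary
   mesh. *)
Record mesh (R : realType) (n : nat) := Mesh {
  cell : finType;
  shape : cell_shape;
  cell_mx : cell -> 'M[R]_n;
  cell_org : cell -> 'rV[R]_n;
  period : set 'rV[R]_n;
  cell_set := fun T : cell =>
    [set x *m cell_mx T + cell_org T | x in ref_cell R n shape];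
  cell_mx_unit : forall T, cell_mx T \in unitmx;
  period0 : period 0;
  periodB : forall p q, period p -> period q -> period (p - q);
  cell_distinct : forall (S T : cell) p, period p ->
    [set x + p | x in cell_set S] = cell_set T -> S = T /\ p = 0;
  cell_conforming : forall (S T : cell) p, period p ->
    is_face (cell_set S `&` [set x | cell_set T (x + p)]) (cell_set S)
}.

Section Forms.
Variables (R : realType) (n : nat) (M : mesh R n).

(* Piecewise forms: on the closed cell T, a 1-form is given by its components
   w T x 0 k = w_x(e_k), and a 2-form by the matrix w T x k l = w_x(e_k, e_l).
   Only the values of w T on cell_set T are meaningful. *)
Definition one_form := cell M -> 'rV[R]_n -> 'rV[R]_n.
Definition two_form := cell M -> 'rV[R]_n -> 'M[R]_n.

Definition ev1 (a u : 'rV[R]_n) : R := (a *m u^T) 0 0.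
Definition ev2 (B : 'M[R]_n) (u v : 'rV[R]_n) : R := (u *m B *m v^T) 0 0.

(* Since cells meet along convex faces, the tangent vectors to a common face at
   x are spanned by the y - x with y in that face: the trace conditions say that
   the pullbacks from both sides to every common face coincide. *)
Definition fe_one_form (w : one_form) : Prop :=
  (forall T x, cell_set T x -> differentiable (w T) x) /\
  (forall S T p x y, period M p ->
     cell_set S x -> cell_set T (x + p) ->
     cell_set S y -> cell_set T (y + p) ->
     ev1 (w S x) (y - x) = ev1 (w T (x + p)) (y - x)).

Definition fe_two_form (w : two_form) : Prop :=
  [/\ (forall T x, cell_set T x -> differentiable (w T) x),
      (forall T x, cell_set T x -> (w T x)^T = - w T x) &
      (forall S T p x y z, period M p ->
         cell_set S x -> cell_set T (x + p) ->
         cell_set S y -> cell_set T (y + p) ->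
         cell_set S z -> cell_set T (z + p) ->
         ev2 (w S x) (y - x) (z - x) = ev2 (w T (x + p)) (y - x) (z - x))].

(* Cellwise exterior derivative: (dw)(e_k, e_l) = d_k w_l - d_l w_k. By the
   trace conditions no jump terms arise at the cell interfaces. *)
Definition ext_d (w : one_form) : two_form := fun T x =>
  \matrix_(k, l) ('D_(delta_mx 0 k) (fun y => w T y 0 l) x
                  - 'D_(delta_mx 0 l) (fun y => w T y 0 k) x).

(* The finite element spaces are the spans of these families. *)
Definition fe_one_form_basis (N : nat) (L : 'I_N -> one_form) : Prop :=
  (forall i, fe_one_form (L i)) /\
  (forall a : 'cV[R]_N,
     (forall T x, cell_set T x -> \sum_i a i 0 *: L i T x = 0) -> a = 0).

Definition fe_two_form_basis (N : nat) (L : 'I_N -> two_form) : Prop :=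
  (forall j, fe_two_form (L j)) /\
  (forall b : 'cV[R]_N,
     (forall T x, cell_set T x -> \sum_j b j 0 *: L j T x = 0) -> b = 0).

(* C^T Lambda^2 = d Lambda^1 *)
Definition discrete_curl (N1 N2 : nat) (L1 : 'I_N1 -> one_form)
    (L2 : 'I_N2 -> two_form) (C : 'M[R]_(N2, N1)) : Prop :=
  forall i T x, cell_set T x ->
    \sum_j (C^T) i j *: L2 j T x = ext_d (L1 i) T x.

End Forms.

Section Symplectic.
Variable R : realType.

Definition jacobian_mx (m n : nat) (f : 'cV[R]_n -> 'cV[R]_m) (z : 'cV[R]_n) :
    'M[R]_(m, n) :=
  \matrix_(i, j) 'D_(delta_mx j 0) (fun y => f y i 0) z.

Definition Omega (N : nat) : 'M[R]_(N + N) := block_mx 0 1%:M (- 1%:M) 0.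

Definition symplectic (N : nat) (f : 'cV[R]_(N + N) -> 'cV[R]_(N + N)) : Prop :=
  forall z, differentiable f z /\
    (jacobian_mx f z)^T *m Omega N *m jacobian_mx f z = Omega N.

End Symplectic.

Section Splitting.
Variables (R : realType) (N1 N2 : nat) (c : R) (C : 'M[R]_(N2, N1)).
Variables (Q1 : 'M[R]_N1) (M2 : 'M[R]_N2).

(* The phase point (a, e) is col_mx a e. *)
Definition Phi_e (tau : R) (z : 'cV[R]_(N1 + N1)) : 'cV[R]_(N1 + N1) :=
  let a := usubmx z in let e := dsubmx z in
  col_mx (a - tau *: (Q1 *m e)) e.

Definition Phi_a (tau : R) (z : 'cV[R]_(N1 + N1)) : 'cV[R]_(N1 + N1) :=
  let a := usubmx z in let e := dsubmx z in
  col_mx a (e + (tau * c ^+ 2) *: (C^T *m M2 *m C *m a)).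

Inductive substep := Se of R | Sa of R.

Definition substep_map (tau : R) (s : substep) :=
  match s with
  | Se alpha => Phi_e (alpha * tau)
  | Sa beta => Phi_a (beta * tau)
  end.

(* The head of the sequence is the outermost map. *)
Definition splitting_map (scheme : seq substep) (tau : R) :
    'cV[R]_(N1 + N1) -> 'cV[R]_(N1 + N1) :=
  foldr (fun s f => substep_map tau s \o f) id scheme.

End Splitting.

(* Main.v *)
Require Import Defs.
From HB Require Import structures.
From mathcomp Require Import all_boot all_order all_algebra.
From mathcomp Require Import all_classical all_reals all_analysis.
Import Order.TTheory GRing.Theory Num.Theory.
Import numFieldNormedType.Exports.
Local Open Scope classical_set_scope.
Local Open Scope ring_scope.

(* Each shear is a linear map whose matrix is block unitriangular with a
   symmetric off-diagonal block, because Q1 and C^T M2 C are symmetric; such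
   matrices preserve Omega. The matrices A with A^T Omega A = Omega are closed
   under multiplication, so the composed map is linear with such a matrix, and
   the Jacobian of a linear map is its matrix. *)

Lemma differentiable_mulmx (R : realType) (m n : nat) (A : 'M[R]_(m, n))
    (z : 'cV[R]_n) : differentiable (mulmx A) z.
Proof.
(* As a combination of the fixed columns of [A], the product depends on [y] only through its
   coordinates, which are differentiable. *)
have -> : mulmx A = \sum_j (fun y : 'cV[R]_n => y j 0 *: col j A).
  apply/funext => y; rewrite fct_sumE; apply/colP => i.
  by rewrite mxE summxE; apply: eq_bigr => j _; rewrite !mxE mulrC.
apply: differentiable_sum => j.
exact/differentiableZl/differentiable_coord.
Qed.

Lemma jacobian_mx_mulmx (R : realType) (m n : nat) (A : 'M[R]_(m, n))
    (z : 'cV[R]_n) : jacobian_mx (mulmx A) z = A.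
Proof.
apply/matrixP => i j; rewrite mxE.
pose f (y : 'cV[R]_n) : R := (A *m y) i 0.
have f_lin : linear f by move=> a u v; rewrite /f linearP !mxE.
pose fL : {linear _ -> _} :=
  HB.pack f (GRing.isLinear.Build _ _ _ _ _ f_lin).
have df y : differentiable f y.
  apply: (differentiable_comp (g := fun w : 'cV[R]_m => w i 0)).
    exact: differentiable_mulmx.
  exact: differentiable_coord.
(* The directional derivative is the differential applied to a basis vector, and a continuous linear
   map is its own differential. *)
rewrite (deriveE _ (df z)) (diff_lin (f := fL)); last first.
  by move=> y; exact: differentiable_continuous (df y).
by rewrite /= /f -colE mxE.
Qed.

Definition symplectic_mx (R : realType) (N : nat) (A : 'M[R]_(N + N)) : Prop :=
  A^T *m Omega R N *m A = Omega R N.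

Lemma symplectic_mulmx (R : realType) (N : nat) (A : 'M[R]_(N + N)) :
  symplectic_mx R N A -> symplectic (mulmx A).
Proof.
move=> hA z; split; first exact: differentiable_mulmx.
by rewrite jacobian_mx_mulmx.
Qed.

Lemma symplectic_mx1 (R : realType) (N : nat) : symplectic_mx R N 1%:M.
Proof. by rewrite /symplectic_mx trmx1 mul1mx mulmx1. Qed.

Lemma symplectic_mxM (R : realType) (N : nat) (A B : 'M[R]_(N + N)) :
  symplectic_mx R N A -> symplectic_mx R N B -> symplectic_mx R N (A *m B).
Proof.
rewrite /symplectic_mx => hA hB.
by rewrite trmx_mul mulmxA -(mulmxA B^T) -(mulmxA B^T) hA hB.
Qed.

(** The product differs from [Omega] only in the lower right block, [S^T - S], which symmetry
    cancels. *)
Lemma symplectic_mx_upper (R : realType) (N : nat) (S : 'M[R]_N) :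
  S^T = S -> symplectic_mx R N (block_mx 1%:M S 0 1%:M).
Proof.
move=> hS; rewrite /symplectic_mx /Omega tr_block_mx !trmx1 trmx0 hS.
rewrite !mulmx_block !(mulmx0, mul0mx, addr0, add0r).
by rewrite !(mulmx1, mul1mx, mulmxN, mulNmx) addNr.
Qed.

(** Here the defect [S - S^T] sits in the upper left block. *)
Lemma symplectic_mx_lower (R : realType) (N : nat) (S : 'M[R]_N) :
  S^T = S -> symplectic_mx R N (block_mx 1%:M 0 S 1%:M).
Proof.
move=> hS; rewrite /symplectic_mx /Omega tr_block_mx !trmx1 trmx0 hS.
rewrite !mulmx_block !(mulmx0, mul0mx, addr0, add0r).
by rewrite !(mulmx1, mul1mx, mulmxN, mulNmx) addNr.
Qed.

Lemma symmetricmxP (R : realType) (n : nat) (A : 'M[R]_n) :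
  reflect (A^T = A) (A \is symmetricmx).
Proof.
(* Symmetric means Hermitian with sign exponent 0 and the identity as conjugation. *)
rewrite is_hermitianmxE expr0 scale1r map_mx_id // eq_sym.
exact: eqP.
Qed.

Lemma splitting_map_mulmx (R : realType) (N1 N2 : nat) (c : R)
    (C : 'M[R]_(N2, N1)) (Q1 : 'M[R]_N1) (M2 : 'M[R]_N2)
    (scheme : seq (substep R)) (tau : R) :
  Q1^T = Q1 -> M2^T = M2 ->
  exists2 A, symplectic_mx R N1 A &
    splitting_map c C Q1 M2 scheme tau = mulmx A.
Proof.
move=> hQ hM; elim: scheme => [|s scheme [A hA eqA]] /=.
  exists 1%:M; first exact: symplectic_mx1.
  by apply/funext => z; rewrite mul1mx.
(* The head is applied last, so its matrix [B] multiplies on the left; one shear remains to be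
   treated. *)
suff [B hB eqB] : exists2 B, symplectic_mx R N1 B &
    substep_map c C Q1 M2 tau s = mulmx B.
  exists (B *m A); first exact: symplectic_mxM.
  by rewrite eqA eqB; apply/funext => z /=; rewrite mulmxA.
case: s => t /=.
- exists (block_mx 1%:M (- (t * tau *: Q1)) 0 1%:M).
    by apply: symplectic_mx_upper; rewrite linearN linearZ /= hQ.
  apply/funext => z; rewrite -[z in RHS]vsubmxK mul_block_col.
  by rewrite !mul1mx mul0mx add0r mulNmx -scalemxAl.
- exists (block_mx 1%:M 0 (t * tau * c ^+ 2 *: (C^T *m M2 *m C)) 1%:M).
    apply: symplectic_mx_lower.
    (* The congruence [C^T *m M2 *m C] inherits symmetry from [M2]. *)
    by rewrite linearZ /= !trmx_mul trmxK hM mulmxA.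
  apply/funext => z; rewrite -[z in RHS]vsubmxK mul_block_col.
  by rewrite !mul1mx mul0mx addr0 -scalemxAl addrC.
Qed.

Theorem theorem3p1 (R : realType) (n : nat) (M : mesh R n) (N1 N2 : nat)
    (L1 : 'I_N1 -> one_form M) (L2 : 'I_N2 -> two_form M)
    (hL1 : fe_one_form_basis L1) (hL2 : fe_two_form_basis L2)
    (c : R) (hc : 0 < c)
    (C : 'M[R]_(N2, N1)) (hC : discrete_curl L1 L2 C)
    (Q1 : 'M[R]_N1) (hQ1 : Q1 \is symmetricmx)
    (M2 : 'M[R]_N2) (hM2 : M2 \is symmetricmx)
    (scheme : seq (substep R)) (tau : R) :
  symplectic (splitting_map c C Q1 M2 scheme tau).
Proof.
move: hQ1 hM2 => /symmetricmxP hQ /symmetricmxP hM.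
have [A hA ->] := splitting_map_mulmx _ _ _ c C _ _ scheme tau hQ hM.
exact: symplectic_mulmx.
Qed.
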